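(* Let $M$ be an $L$-structure and $\phi(x,y)$ an $L$-formula. Let $\epsilon>0$ and suppose $\phi(x,y)$ is $\epsilon$-stable in $M$. Fix $\gamma>\delta>0$ and let $p\in S_{\phi(x)}(M)$. Then there is a $\phi^*(y)$-formula $\psi(y)$ over $M$ such that $$\sup_{b\in M^y}\mathfrak d(\psi^M(b),\phi(p,b))\leq2\epsilon+\gamma.$$ Moreover, $\psi(y)$ is $\operatorname{diam}_M(\phi)/\delta$-Lipschitz as a function on the metric space $S_{\phi^*(y)}(M)$.
   Context: Logic: We work in continuous (metric) first-order logic with values in $\mathfrak V=\ell^\infty(\omega)$ (real Banach space), with metric $\mathfrak d(\mathfrak r,\mathfrak s)=\|\mathfrak r-\mathfrak s\|_\infty$; an isometric copy $\mathbb R\hookrightarrow\mathfrak V$ is fixed. It is set up as standard $[0,1]$-valued continuous logic (complete metric structures, possibly many-sorted, symbols with prescribed moduli of uniform continuity), except that each predicate symbol $P$ of the language $L$ comes with a compact set $K_P\subseteq\mathfrak V$ in which it takes values; connectives are all continuous functions $u:\mathfrak V^n\to\mathfrak V$; and $\sup_x\psi$, $\inf_x\psi$ are formed only for formulas $\psi$ with value set $K_\psi\subseteq\mathbb R^{\geq0}$. Inductively each formula $\phi$ has a compact value set $K_\phi\subseteq\mathfrak V$ ($K_{u(\phi_0,\ldots,\phi_{n-1})}=u(\prod_i K_{\phi_i})$, and $K_{\sup_x\psi}=K_{\inf_x\psi}=K_\psi$), and $\phi^M$ takes values in $K_\phi$ in every $L$-structure $M$. Here $x,y$ are tuples of variables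 and $M^x$ is the product of sorts of $M$ corresponding to $x$. $N\succeq M$ means $N$ is an elementary extension of $M$. $\operatorname{diam}_M(\phi)=\sup\{\mathfrak d(\phi^M(a,b),\phi^M(a',b')):a,a'\in M^x,\ b,b'\in M^y\}$. Types: $\phi^*(y,x)$ is the formula $\phi(x,y)$ with the roles of object and parameter variables swapped. $S_{\phi(x)}(M)$ is the set of complete $\phi(x)$-types over $M$. A type $p\in S_{\phi(x)}(M)$ is determined by the function $b\mapsto\phi(p,b)$ from $M^y$ to $K_\phi$, where $\phi(p,b)=\phi^N(a,b)$ for any realization $a\in N^x$ of $p$ in some $N\succeq M$. Likewise, $S_{\phi^*(y)}(M)$ is the set of complete $\phi^*(y)$-types over $M$, a type $q$ being determined by $a\mapsto\phi^*(q,a)$, $a\in M^x$; its metric is $d(q,q')=\sup_{a\in M^x}\mathfrak d(\phi^*(q,a),\phi^*(q',a))$. A $\phi^*(y)$-formula over $M$ is a formula of the form $u(\phi(a_0,y),\ldots,\phi(a_{n-1},y))$ with $a_i\in M^x$ and $u:\mathfrak V^n\to\mathfrak V$ continuous; it is evaluated on $q\in S_{\phi^*(y)}(M)$ by $u(\phi^*(q,a_0),\ldots,\phi^*(q,a_{n-1}))$. Stability: $\phi(x,y)$ is $\epsilon$-stable in $M$ if there are no sequences $\langle a_i\rangle_{i<\omega}$ in $M^x$ and $\langle b_i\rangle_{i<\omega}$ in $M^y$ such that $\mathfrak d(\phi^M(a_i,b_j),\phi^M(a_j,b_i))\geq\epsilon$ for all $i<j<\omega$. *)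

(* Defs.v *)
From HB Require Import structures.
From mathcomp Require Import all_boot all_order all_algebra.
From mathcomp Require Import all_classical all_reals all_analysis.

Set Implicit Arguments.
Unset Strict Implicit.
Unset Printing Implicit Defensive.

Import Order.TTheory GRing.Theory Num.Theory.
Import numFieldNormedType.Exports.

Local Open Scope classical_set_scope.
Local Open Scope ring_scope.

Section linfty.
Variable R : realType.

Definition bounded_seq : {pred nat -> R} :=
  mem [set f : nat -> R | has_ubound (range (fun n => `|f n|))].

Lemma bounded_seqP (f : nat -> R) :
  (exists B, forall n, `|f n| <= B) <-> f \in bounded_seq.
Proof.
rewrite inE; split=> [[B fB]|[B fB]]; exists B; first by move=> _ [n _ <-].
by move=> n; apply: fB; exists n.
Qed.

Lemma bounded_seq_submod_closed : submod_closed bounded_seq.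
Proof.
split; first by apply/bounded_seqP; exists 0 => n; rewrite normr0.
move=> r f g /bounded_seqP[B fB] /bounded_seqP[C gC].
apply/bounded_seqP; exists (`|r| * B + C) => n.
rewrite (le_trans (ler_normD _ _))// lerD//= normrM.
by rewrite ler_wpM2l.
Qed.

HB.instance Definition _ := GRing.isSubmodClosed.Build _ _ bounded_seq
  bounded_seq_submod_closed.

Record linfty := Linfty {
  linfty_fun :> nat -> R ;
  linfty_bounded : linfty_fun \in bounded_seq }.

HB.instance Definition _ := [isSub for linfty_fun].
HB.instance Definition _ := [Choice of linfty by <:].
HB.instance Definition _ := [SubChoice_isSubLmodule of linfty by <:].

Definition supnorm (f : linfty) : R := sup (range (fun n => `|f n|)).

Lemma supnorm_ub (f : linfty) n : `|f n| <= supnorm f.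
Proof.
apply: ub_le_sup; last by exists n.
by have := linfty_bounded f; rewrite inE.
Qed.

Lemma supnorm_le (f : linfty) B : (forall n, `|f n| <= B) -> supnorm f <= B.
Proof.
move=> fB; apply: ge_sup; first by exists `|f 0%N|, 0%N.
by move=> _ [n _ <-].
Qed.

Let supnormD f g : supnorm (f + g) <= supnorm f + supnorm g.
Proof.
apply: supnorm_le => n; rewrite (le_trans (ler_normD _ _))//.
by rewrite lerD// supnorm_ub.
Qed.

Let supnormZ r f : supnorm (r *: f) = `|r| * supnorm f.
Proof.
have le_Z s g : supnorm (s *: g) <= `|s| * supnorm g.
  apply: supnorm_le => n; rewrite [(s *: g) n]/(s * g n) normrM.
  by rewrite ler_wpM2l// supnorm_ub.
have [->|r0] := eqVneq r 0.
  apply/eqP; rewrite scale0r normr0 mul0r eq_le supnorm_le; last first.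
    by move=> n; rewrite normr0.
  exact: le_trans (normr_ge0 _) (supnorm_ub 0 0%N).
apply/eqP; rewrite eq_le le_Z/=.
have := le_Z r^-1 (r *: f); rewrite scalerA mulVf// scale1r normfV.
by rewrite -(@ler_pM2l _ `|r|) ?normr_gt0// mulrA divff ?mul1r// normr_eq0.
Qed.

Let supnorm0_eq0 f : supnorm f = 0 -> f = 0.
Proof.
move=> f0; apply/val_inj/funext => n; apply/eqP.
by have := supnorm_ub f n; rewrite f0 normr_le0.
Qed.

HB.instance Definition _ :=
  Lmodule_isNormed.Build R linfty supnormD supnormZ supnorm0_eq0.

Lemma linfty_normE (f : linfty) : `|f| = sup (range (fun n => `|f n|)).
Proof. by []. Qed.

End linfty.

(** An isometric copy of the reals inside the value space.  Linearity is not
    imposed. *)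
Record real_copy (R : realType) := RealCopy {
  real_emb :> R -> linfty R ;
  real_emb_isometry : forall r s, `|real_emb r - real_emb s| = `|r - s| }.

(** A finite tuple of variables, each with its sort. *)
Record ctx (sort : Type) := Ctx { var : finType ; vsort : var -> sort }.
Arguments vsort {sort c}.

Definition ctx_sum sort (x y : ctx sort) : ctx sort :=
  Ctx (fun v : var x + var y =>
         match v with inl i => vsort i | inr j => vsort j end).

Definition ctx_ext sort (G : ctx sort) (s : sort) : ctx sort :=
  Ctx (fun v : option (var G) => if v is Some i then vsort i else s).

Record language (R : realType) := Language {
  sorts : Type ;
  fsym : Type ;
  fdom : fsym -> ctx sorts ;
  fcod : fsym -> sorts ;
  fmod : fsym -> R -> R ;
  fmod_gt0 : forall f e, 0 < e -> 0 < fmod f e ;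
  psym : Type ;
  pdom : psym -> ctx sorts ;
  pmod : psym -> R -> R ;
  pmod_gt0 : forall P e, 0 < e -> 0 < pmod P e ;
  pval : psym -> set (linfty R) ;
  pval_compact : forall P, compact (pval P) }.

#[short(type="completeMetricType")]
HB.structure Definition CompleteMetric (K : numDomainType) :=
  {T of Metric K T & Complete T}.

Definition env_of sort (C : sort -> Type) (G : ctx sort) :=
  forall v : var G, C (vsort v).

(** Sorts are nonempty, being pointed, and have diameter at most 1.  The moduli
    refer to the maximum metric on products. *)
Record structure (R : realType) (L : language R) := Structure {
  carrier :> sorts L -> completeMetricType R ;
  mdist_le1 : forall s (a b : carrier s), mdist a b <= 1 ;
  fint : forall f : fsym L, env_of carrier (fdom f) -> carrier (fcod f) ;
  fint_unif : forall f (a b : env_of carrier (fdom f)) e, 0 < e ->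
    (forall v, mdist (a v) (b v) < fmod f e) ->
    mdist (fint a) (fint b) <= e ;
  pint : forall P : psym L, env_of carrier (pdom P) -> linfty R ;
  pint_val : forall P (a : env_of carrier (pdom P)), pval P (pint a) ;
  pint_unif : forall P (a b : env_of carrier (pdom P)) e, 0 < e ->
    (forall v, mdist (a v) (b v) < pmod P e) ->
    `|pint a - pint b| <= e }.

(** The product [M^x] of the sorts corresponding to [x]. *)
Definition env (R : realType) (L : language R) (M : structure L)
  (x : ctx (sorts L)) := env_of (carrier M) x.

Definition env_pair (R : realType) (L : language R) (M : structure L)
    (x y : ctx (sorts L)) (a : env M x) (b : env M y) : env M (ctx_sum x y) :=
  fun v => match v with inl i => a i | inr j => b j end.

Definition env_ext (R : realType) (L : language R) (M : structure L)
    (G : ctx (sorts L)) (s : sorts L) (e : env M G) (a : M s) :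
    env M (ctx_ext G s) :=
  fun v => match v with Some i => e i | None => a end.

Inductive term (R : realType) (L : language R) (G : ctx (sorts L)) :
    sorts L -> Type :=
| Var (v : var G) : term G (vsort v)
| App (f : fsym L) (t : forall v : var (fdom f), term G (vsort v)) :
    term G (fcod f).

(** [formula iota G K] is the type of formulas with free variables in [G] and
    value set [K].  The index [K] makes the side condition on quantifiers part
    of the formation rules. *)
Inductive formula (R : realType) (iota : real_copy R) (L : language R) :
    ctx (sorts L) -> set (linfty R) -> Type :=
| Dist (G : ctx (sorts L)) (s : sorts L) (t1 t2 : term G s) :
    formula iota G (iota @` [set r | 0 <= r <= 1])
| Pred (G : ctx (sorts L)) (P : psym L) (t : forall v : var (pdom P), term G (vsort v)) :
    formula iota G (pval P)
| Conn (G : ctx (sorts L)) n (u : 'rV[linfty R]_n -> linfty R) (u_cont : continuous u)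
    (K : 'I_n -> set (linfty R)) (psi : forall i, formula iota G (K i)) :
    formula iota G (u @` [set v : 'rV_n | forall i, K i (v ord0 i)])
| Sup (G : ctx (sorts L)) (s : sorts L) (K : set (linfty R))
    (psi : formula iota (ctx_ext G s) K)
    (K_ge0 : K `<=` iota @` [set r | 0 <= r]) :
    formula iota G K
| Inf (G : ctx (sorts L)) (s : sorts L) (K : set (linfty R))
    (psi : formula iota (ctx_ext G s) K)
    (K_ge0 : K `<=` iota @` [set r | 0 <= r]) :
    formula iota G K.

Section semantics.
Variables (R : realType) (iota : real_copy R) (L : language R).
Variable M : structure L.

Fixpoint teval (G : ctx (sorts L)) s (t : term G s) (e : env M G) : M s :=
  match t with
  | Var v => e v
  | App f t => fint (fun v => teval (t v) e)
  end.

Fixpoint eval (G : ctx (sorts L)) K (phi : formula iota G K) :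
    env M G -> linfty R :=
  match phi with
  | Dist _ _ t1 t2 => fun e => iota (mdist (teval t1 e) (teval t2 e))
  | Pred _ _ t => fun e => pint (fun v => teval (t v) e)
  | Conn _ _ u _ _ psi => fun e => u (\row_i eval (psi i) e)
  | Sup _ s _ psi _ => fun e =>
      iota (sup [set r | exists a : M s, iota r = eval psi (env_ext e a)])
  | Inf _ s _ psi _ => fun e =>
      iota (inf [set r | exists a : M s, iota r = eval psi (env_ext e a)])
  end.

Lemma formula_compact (G : ctx (sorts L)) K (phi : formula iota G K) :
  compact K.
Proof.
elim: phi => {G K} [G s _ _|G P _|G n u u_cont K psi IH|//|//].
- apply: continuous_compact; last first.
    rewrite (_ : mkset _ = `[0, 1]%classic); first exact: segment_compact.
    by apply/seteqP; split=> r /=; rewrite in_itv.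
  apply: continuous_subspaceT => r; apply/cvgrPdist_lt => e e0.
  near=> t; rewrite real_emb_isometry.
  by near: t; exact: cvgr_dist_lt.
- exact: pval_compact.
- apply: continuous_compact; first exact: continuous_subspaceT.
  exact: rV_compact.
Unshelve. all: by end_near. Qed.

Lemma eval_in_val (G : ctx (sorts L)) K (phi : formula iota G K) (e : env M G) :
  K (eval phi e).
Proof.
have K_bnd (G' : ctx (sorts L)) K' : formula iota G' K' ->
    exists B, forall r, K' (iota r) -> `|r| <= B.
  move=> psi; have [B [_ KB]] := compact_bounded (formula_compact psi).
  exists (B + 1 + `|iota 0|) => r Kr.
  rewrite -[r in leLHS]subr0 -(real_emb_isometry iota) (le_trans (ler_normB _ _))//.
  by rewrite lerD2r; apply: KB; rewrite // ltrDl.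
have K_cl (G' : ctx (sorts L)) K' : formula iota G' K' -> closed K'.
  by move=> /formula_compact; apply: compact_closed; exact: norm_hausdorff.
elim: phi e => {G K}.
- move=> G s t1 t2 e /=; exists (mdist (teval t1 e) (teval t2 e)) => //=.
  by rewrite mdist_ge0 mdist_le1.
- by move=> G P t e /=; exact: pint_val.
- move=> G n u u_cont K psi IH e /=.
  by exists (\row_i eval (psi i) e) => //= i; rewrite mxE; exact: IH.
- move=> G s K psi IH K_ge0 e /=; set A := [set r | _].
  have AK r : A r -> K (iota r) by move=> [a ->]; exact: IH.
  have A0 : A !=set0.
    have [r _ rE] := K_ge0 _ (IH (env_ext e (point : M s))).
    by exists r, point.
  have [B KB] := K_bnd _ _ psi.
  have Asup : has_sup A.
    by split=> //; exists B => r /AK/KB; apply: le_trans; exact: ler_norm.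
  apply: (K_cl _ _ psi) => U /nbhs_ballP[d /= d0 dU].
  have [r Ar rd] := sup_adherent d0 Asup.
  exists (iota r); split; first exact: AK.
  apply: dU; rewrite -ball_normE /= real_emb_isometry ger0_norm ?subr_ge0.
    by rewrite ltrBlDr addrC -ltrBlDr.
  exact: sup_upper_bound.
- move=> G s K psi IH K_ge0 e /=; set A := [set r | _].
  have AK r : A r -> K (iota r) by move=> [a ->]; exact: IH.
  have A0 : A !=set0.
    have [r _ rE] := K_ge0 _ (IH (env_ext e (point : M s))).
    by exists r, point.
  have [B KB] := K_bnd _ _ psi.
  have Ainf : has_inf A.
    split=> //; exists (- B) => r /AK/KB rB.
    by rewrite lerNl (le_trans _ rB)// -normrN ler_norm.
  apply: (K_cl _ _ psi) => U /nbhs_ballP[d /= d0 dU].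
  have [r Ar rd] := inf_adherent d0 Ainf.
  exists (iota r); split; first exact: AK.
  apply: dU; rewrite -ball_normE /= real_emb_isometry distrC ger0_norm.
    by rewrite ltrBlDl.
  by rewrite subr_ge0; apply: ge_inf => //; case: Ainf.
Qed.

End semantics.

(** [N] is an elementary extension of (a copy of) [M]. *)
Record elementary_extension (R : realType) (iota : real_copy R)
    (L : language R) (M N : structure L) := ElementaryExtension {
  elem_map :> forall s, M s -> N s ;
  elem_mapP : forall G K (phi : formula iota G K) (e : env M G),
    eval phi ((fun v => elem_map (e v)) : env N G) = eval phi e }.

Definition elem_env (R : realType) (iota : real_copy R) (L : language R)
    (M N : structure L) (j : elementary_extension iota M N)
    (x : ctx (sorts L)) (a : env M x) : env N x :=
  fun v => j _ (a v).

(** The interpretations of a formula in all structures, as functions of an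
    object tuple and a parameter tuple.  [phi] and the formula with the roles
    of the two tuples swapped are both seen this way. *)
Definition interp (R : realType) (L : language R) (x y : ctx (sorts L)) :=
  forall M : structure L, env M x -> env M y -> linfty R.

Definition interp_of (R : realType) (iota : real_copy R) (L : language R)
    (x y : ctx (sorts L)) K (phi : formula iota (ctx_sum x y) K) :
    interp x y :=
  fun M a b => eval phi (env_pair a b).

Definition dual (R : realType) (L : language R) (x y : ctx (sorts L))
    (F : interp x y) : interp y x :=
  fun M b a => F M a b.

(** A complete type over [M] is identified with the function
    [b |-> phi(p, b)] which determines it. *)
Definition types (R : realType) (iota : real_copy R) (L : language R)
    (x y : ctx (sorts L)) (F : interp x y) (M : structure L) :
    set (env M y -> linfty R) :=
  [set p | exists (N : structure L) (j : elementary_extension iota M N)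
             (a : env N x), forall b, p b = F N a (elem_env j b)].

Section phi_types.
Variables (R : realType) (iota : real_copy R) (L : language R).
Variables (x y : ctx (sorts L)) (K : set (linfty R)).
Variables (phi : formula iota (ctx_sum x y) K) (M : structure L).

Definition S_phi : set (env M y -> linfty R) :=
  types iota (interp_of phi) (M := M).

Definition S_phi_dual : set (env M x -> linfty R) :=
  types iota (dual (interp_of phi)) (M := M).

(** [u(phi(a_0, y), ..., phi(a_(n-1), y))] *)
Record dual_formula := DualFormula {
  df_arity : nat ;
  df_conn : 'rV[linfty R]_df_arity -> linfty R ;
  df_conn_continuous : continuous df_conn ;
  df_param : 'I_df_arity -> env M x }.
Arguments df_conn : clear implicits.
Arguments df_param : clear implicits.

Definition df_eval (psi : dual_formula) (b : env M y) : linfty R :=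
  df_conn psi (\row_i eval phi (env_pair (df_param psi i) b)).

Definition df_eval_type (psi : dual_formula) (q : env M x -> linfty R) :
    linfty R :=
  df_conn psi (\row_i q (df_param psi i)).

Definition stable (eps : R) :=
  ~ exists (a : nat -> env M x) (b : nat -> env M y),
      forall i j : nat, (i < j)%N ->
        eps <= `|eval phi (env_pair (a i) (b j)) -
                 eval phi (env_pair (a j) (b i))|.

Definition diam : \bar R :=
  ereal_sup [set d | exists (a a' : env M x) (b b' : env M y),
    d = `|eval phi (env_pair a b) - eval phi (env_pair a' b')|%:E].

End phi_types.

Arguments df_conn {R L x M} d v.
Arguments df_param {R L x M} d i.
Arguments stable {R iota L x y K} phi M eps.
Arguments S_phi {R iota L x y K} phi M.
Arguments S_phi_dual {R iota L x y K} phi M.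
Arguments diam {R iota L x y K} phi M.

(** [sup_t d(f t, g t)]; taken in the extended reals, so that no boundedness
    side condition is needed for it to be meaningful. *)
Definition dist_sup (R : realType) (T : Type) (f g : T -> linfty R) : \bar R :=
  ereal_sup (range (fun t => `|f t - g t|%:E)).

(* Main.v *)
Require Import Defs.
From mathcomp Require Import all_boot all_order all_algebra.
From mathcomp Require Import all_classical all_reals all_analysis.
From mathcomp Require Import lra.
Import Order.TTheory GRing.Theory Num.Theory.
Import numFieldNormedType.Exports.
Local Open Scope classical_set_scope.
Local Open Scope ring_scope.

(** Write [f a b] for [phi(a, b)].  Stability gives a finite set of parameters
    [a] such that [p b] and [p b'] are within [2 * eps + gamma] whenever
    [f a b] and [f a b'] are within [delta] for all these [a].  Indeed, from
    counterexamples [b_n, b'_n] for larger and larger finite sets, with [p b_n]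
    and [p b'_n] converging to [r] and [r'], and elements [a_n] approximating
    [p] on the earlier [b_i, b'_i], one has [f a_j b_i] close to [r] for
    [i < j], while [f a_i b_j] is far from [r] (or the same holds for [b'] and
    [r']), which contradicts stability.

    Hence, with [D] the diameter of [phi] and [d] the maximum distance on the
    finite tuples [(f a b)_a],
    [|p b - p b'| <= 2 * eps + gamma + (D / delta) * d b b'] for all [b, b'],
    and a McShane extension, which exists because the value space is
    l-infinity, turns [p] into a [D / delta]-Lipschitz function of these
    tuples. *)

Set Implicit Arguments.
Unset Strict Implicit.
Unset Printing Implicit Defensive.

(* [all_analysis] exports another [eval]. *)
Local Notation eval := Defs.eval.

(** * Substitution of terms in formulas *)

Section substitution.
Variables (R : realType) (iota : real_copy R) (L : language R).

Definition substitution (G G' : ctx (sorts L)) :=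
  forall v : var G, term G' (vsort v).

Fixpoint term_subst (G G' : ctx (sorts L)) (sigma : substitution G G') s
    (t : term G s) : term G' s :=
  match t in term _ s return term G' s with
  | Var v => sigma v
  | App f t => App (fun v => term_subst sigma (t v))
  end.

Definition subst_lift (G G' : ctx (sorts L)) (sigma : substitution G G') s :
    substitution (ctx_ext G s) (ctx_ext G' s) :=
  fun v =>
    match v return term (ctx_ext G' s) (vsort (v : var (ctx_ext G s))) with
    | Some i => term_subst (fun w => @Var _ _ (ctx_ext G' s) (Some w)) (sigma i)
    | None => @Var _ _ (ctx_ext G' s) None
    end.
Arguments subst_lift {G G'} sigma s v.

(** Substitution keeps the index [K], so the side condition [K_ge0] carries over unchanged. *)
Fixpoint formula_subst (G G' : ctx (sorts L)) K (psi : formula iota G K) :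
    substitution G G' -> formula iota G' K :=
  match psi in formula _ G K return substitution G G' -> formula iota G' K with
  | Dist _ _ t1 t2 => fun sigma =>
      Dist iota (term_subst sigma t1) (term_subst sigma t2)
  | Pred _ _ t => fun sigma => Pred iota (fun v => term_subst sigma (t v))
  | Conn _ _ _ u_cont _ psi => fun sigma =>
      Conn u_cont (fun i => formula_subst (psi i) sigma)
  | Sup _ s _ psi K_ge0 => fun sigma =>
      Sup (formula_subst psi (subst_lift sigma s)) K_ge0
  | Inf _ s _ psi K_ge0 => fun sigma =>
      Inf (formula_subst psi (subst_lift sigma s)) K_ge0
  end.

Variable M : structure L.

Lemma teval_subst (G G' : ctx (sorts L)) (sigma : substitution G G') s
    (t : term G s) (e : env M G') :
  teval (term_subst sigma t) e = teval t (fun v => teval (sigma v) e).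
Proof.
elim: t => [//|f t IH] /=; congr fint.
exact: functional_extensionality_dep.
Qed.

Lemma env_ext_subst (G G' : ctx (sorts L)) (sigma : substitution G G') s
    (e : env M G') (a : M s) :
  (fun v => teval (subst_lift sigma s v) (env_ext e a)) =
  env_ext (fun v => teval (sigma v) e) a.
Proof.
by apply: functional_extensionality_dep => -[v|]//=; rewrite teval_subst.
Qed.

Lemma eval_subst (G G' : ctx (sorts L)) K (psi : formula iota G K)
    (sigma : substitution G G') (e : env M G') :
  eval (formula_subst psi sigma) e = eval psi (fun v => teval (sigma v) e).
Proof.
elim: psi G' sigma e => {G K}.
- by move=> G s t1 t2 G' sigma e /=; rewrite !teval_subst.
- move=> G P t G' sigma e /=; congr pint.
  by apply: functional_extensionality_dep => v; rewrite teval_subst.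
- move=> G n u u_cont K psi IH G' sigma e /=; congr u.
  by apply/rowP => i; rewrite !mxE IH.
- move=> G s K psi IH K_ge0 G' sigma e /=; congr (iota (sup _)).
  by apply/funext => r; congr (exists a, _ = _); apply/funext => a;
    rewrite IH env_ext_subst.
- move=> G s K psi IH K_ge0 G' sigma e /=; congr (iota (inf _)).
  by apply/funext => r; congr (exists a, _ = _); apply/funext => a;
    rewrite IH env_ext_subst.
Qed.

End substitution.

(** * Infima over several variables *)

Section quantify.
Variables (R : realType) (iota : real_copy R) (L : language R).

Lemma real_emb_inj : injective iota.
Proof.
move=> r s rs; apply/eqP; rewrite -subr_eq0 -normr_eq0.
by rewrite -(real_emb_isometry iota) rs subrr normr0.
Qed.

Lemma real_emb_continuous : continuous iota.
Proof.
move=> r; apply/cvgrPdist_lt => e e0; near=> t.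
rewrite real_emb_isometry; near: t.
exact: cvgr_dist_lt.
Unshelve. all: by end_near. Qed.

(** [v] stays in the context and only its occurrences move to the new variable, so the quantified
    formula lives over [G] again and binding can be iterated. The cast is there because sorts depend
    on variables. *)
Definition bind_var (G : ctx (sorts L)) (v : var G) :
    substitution G (ctx_ext G (vsort v)) :=
  fun w => if v =P w is ReflectT vw
    then ecast w (term (ctx_ext G (vsort v)) (vsort w)) vw
           (@Var _ _ (ctx_ext G (vsort v)) None)
    else @Var _ _ (ctx_ext G (vsort v)) (Some w).

Definition inf_var (G : ctx (sorts L)) K
    (K_ge0 : K `<=` iota @` [set r | 0 <= r]) (v : var G)
    (psi : formula iota G K) : formula iota G K :=
  Inf (formula_subst psi (bind_var v)) K_ge0.

Definition inf_vars (G : ctx (sorts L)) K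
    (K_ge0 : K `<=` iota @` [set r | 0 <= r]) (vs : seq (var G))
    (psi : formula iota G K) : formula iota G K :=
  foldr (inf_var K_ge0) psi vs.

Variable M : structure L.

Lemma bind_var_id (G : ctx (sorts L)) (v : var G) (e : env M G) a :
  teval (bind_var v v) (env_ext e a) = a.
Proof.
rewrite /bind_var; case: eqP => // vv.
by rewrite (eq_axiomK vv).
Qed.

Lemma bind_var_neq (G : ctx (sorts L)) (v w : var G) (e : env M G) a :
  v != w -> teval (bind_var v w) (env_ext e a) = e w.
Proof. by rewrite /bind_var; case: eqP. Qed.

Lemma inf_vars_le (G : ctx (sorts L)) K
    (K_ge0 : K `<=` iota @` [set r | 0 <= r]) (vs : seq (var G))
    (psi : formula iota G K) (e e' : env M G) r r' :
  (forall w, w \notin vs -> e w = e' w) ->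
  eval (inf_vars K_ge0 vs psi) e = iota r -> eval psi e' = iota r' -> r <= r'.
Proof.
elim: vs e r => [|v vs IH] e r ee' er er'.
  suff -> : r = r' by [].
  apply: real_emb_inj; rewrite -er -er' /=; congr Defs.eval.
  by apply: functional_extensionality_dep => w; apply: ee'.
(* [e1] is [e] with its value at [v] changed to [e' v]. *)
pose e1 : env M G := fun w => teval (bind_var v w) (env_ext e (e' v)).
have [r1 /= r1_ge0 e1r1] := K_ge0 _ (eval_in_val (inf_vars K_ge0 vs psi) e1).
have r1r' : r1 <= r'.
  apply: (IH e1) => // w wvs; rewrite /e1.
  have [<-|vw] := eqVneq v w; first by rewrite bind_var_id.
  by rewrite bind_var_neq// ee'// inE negb_or eq_sym vw.
apply: le_trans r1r'; move: er => /= /real_emb_inj <-.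
apply: ge_inf; last by exists (e' v); rewrite eval_subst e1r1.
exists 0 => s /= [a]; rewrite eval_subst => sa.
have [t /= t_ge0] := K_ge0 _ (eval_in_val (inf_vars K_ge0 vs psi)
  (fun w => teval (bind_var v w) (env_ext e a))).
by rewrite -sa => /real_emb_inj <-.
Qed.

(** The witness is chosen one variable at a time, each choice keeping the infimum over the remaining
    variables below [c]. *)
Lemma inf_vars_lt (G : ctx (sorts L)) K
    (K_ge0 : K `<=` iota @` [set r | 0 <= r]) (vs : seq (var G))
    (psi : formula iota G K) (e : env M G) r c :
  eval (inf_vars K_ge0 vs psi) e = iota r -> r < c ->
  exists (e' : env M G) r', [/\ forall w, w \notin vs -> e w = e' w,
    eval psi e' = iota r' & r' < c].
Proof.
elim: vs e r => [|v vs IH] e r er rc; first by exists e, r.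
move: er => /= /real_emb_inj er.
have : has_inf [set r | exists a : M (vsort v), iota r =
    eval (formula_subst (inf_vars K_ge0 vs psi) (bind_var v)) (env_ext e a)].
  split.
    have [t _ te] := K_ge0 _ (eval_in_val (inf_vars K_ge0 vs psi)
      (fun w => teval (bind_var v w) (env_ext e point))).
    by exists t, point; rewrite eval_subst.
  exists 0 => s /= [a]; rewrite eval_subst => sa.
  have [t /= t_ge0] := K_ge0 _ (eval_in_val (inf_vars K_ge0 vs psi)
    (fun w => teval (bind_var v w) (env_ext e a))).
  by rewrite -sa => /real_emb_inj <-.
move=> /inf_adherent -/(_ (c - r)); rewrite subr_gt0 => /(_ rc)[s [a]].
rewrite eval_subst er subrKC => /esym sa sc.
have [e' [r' [ee' e'r' r'c]]] := IH _ _ sa sc.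
exists e', r'; split=> // w; rewrite inE negb_or => /andP[wv wvs].
by rewrite -ee'// bind_var_neq// eq_sym.
Qed.

End quantify.

(** * Continuity of the coordinates of a row *)

Section row_topology.
Variables (R : realType) (V : normedModType R) (n : nat).

Lemma row_coord_continuous (i : 'I_n) :
  continuous (fun v : 'rV[V]_n => v ord0 i).
Proof.
move=> v A /nbhs_ballP[e e0 eA]; apply/nbhs_ballP; exists e => // w [_ vw].
exact/eA/vw.
Qed.

End row_topology.

(** * Approximating a type by elements of [M] *)

Section approximation.
Variables (R : realType) (iota : real_copy R) (L : language R).
Variables (x y : ctx (sorts L)) (K : set (linfty R)).
Variables (phi : formula iota (ctx_sum x y) K) (M : structure L).

(** Disjoint copies of [y] let one formula speak of all the [b i] at once. *)
Definition copies n (G : ctx (sorts L)) : ctx (sorts L) :=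
  Ctx (fun v : ('I_n * var G)%type => vsort v.2).

Definition copies_env (M' : structure L) (G : ctx (sorts L)) n
    (c : 'I_n -> env M' G) : env M' (copies n G) :=
  fun v => c v.1 v.2.

Definition to_copy n (i : 'I_n) :
    substitution (ctx_sum x y) (ctx_sum x (copies n y)) :=
  fun v => match v with
    | inl w => @Var _ _ (ctx_sum x (copies n y)) (inl w)
    | inr w => @Var _ _ (ctx_sum x (copies n y)) (inr (i, w))
    end.

Lemma to_copyE (M' : structure L) n (i : 'I_n) (a : env M' x)
    (c : 'I_n -> env M' y) :
  (fun v => teval (to_copy i v) (env_pair a (copies_env c))) = env_pair a (c i).
Proof. by apply: functional_extensionality_dep => -[]. Qed.

Lemma S_phi_val (p : env M y -> linfty R) b : S_phi phi M p -> K (p b).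
Proof. by move=> [N [j [a ->]]]; exact: eval_in_val. Qed.

(* The infimum over [a] of [\sum_i |phi(a, b_i) - p b_i|] is the value of a
   formula, and it vanishes in the extension of [M] realizing [p]. *)
Lemma S_phi_approx (p : env M y -> linfty R) n (b : 'I_n -> env M y) e :
  S_phi phi M p -> 0 < e ->
  exists a : env M x, forall i, `|eval phi (env_pair a (b i)) - p (b i)| < e.
Proof.
move=> [N [j [a pE]]] e0.
(* The values [p (b i)] are built into the connective as constants of the value space. *)
pose u (v : 'rV[linfty R]_n) := iota (\sum_i `|v ord0 i - p (b i)|).
have u_cont : continuous u.
  move=> v; apply: continuous_comp; last exact: real_emb_continuous.
  apply: continuous_big => [|i _ {}v]; first exact: add_continuous.
  apply: (@continuous_comp 'rV[linfty R]_n (linfty R) R (fun v => v ord0 i)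
    (fun z : linfty R => `|z - p (b i)|)).
    exact: row_coord_continuous.
  apply: (@continuous_comp _ _ _ (fun z : linfty R => z - p (b i)) Num.norm).
    by apply: continuousB => //; exact: cst_continuous.
  exact: norm_continuous.
pose psi := Conn u_cont (fun i => formula_subst phi (to_copy i)).
have psi_ge0 : u @` [set v : 'rV_n | forall i, K (v ord0 i)] `<=`
    iota @` [set r | 0 <= r].
  move=> _ [v _ <-]; exists (\sum_i `|v ord0 i - p (b i)|) => //=.
  exact: sumr_ge0.
pose vs : seq (var (ctx_sum x (copies n y))) := map inl (enum (var x)).
have psiE (M' : structure L) (a' : env M' x) (c : 'I_n -> env M' y) :
    eval psi (env_pair a' (copies_env c)) =
    iota (\sum_i `|eval phi (env_pair a' (c i)) - p (b i)|).
  rewrite /= /u; congr (iota _); apply: eq_bigr => i _.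
  by rewrite mxE eval_subst to_copyE.
(* [a0] only fills the places bound by [vs]; in [N] the realization [a] may take them. *)
pose a0 : env M x := fun=> point.
pose e0' := env_pair a0 (copies_env b).
have [r /= r_ge0 er] := psi_ge0 _ (eval_in_val (inf_vars psi_ge0 vs psi) e0').
have r0 : r < e.
  apply: le_lt_trans e0; move: er; rewrite -(elem_mapP j) => /esym er.
  have := psiE N a (fun i => elem_env j (b i)).
  rewrite big1 => [|i _]; last by rewrite pE subrr normr0.
  apply: inf_vars_le er.
  case=> [w|[i w]]//= /negP[]; rewrite mem_map ?mem_enum// => ? ? [//].
have [e' [r' [ee' e'r' r'e]]] := inf_vars_lt (esym er) r0.
exists (fun v => e' (inl v)) => i; apply: le_lt_trans r'e.
have e'E : e' = env_pair ((fun v => e' (inl v)) : env M x) (copies_env b).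
  apply: functional_extensionality_dep => -[w|[k w]]//=.
  by rewrite -ee'//; apply/negP => /mapP[].
move: e'r'; rewrite e'E psiE => /real_emb_inj <-.
by rewrite (bigD1 i)//= lerDl sumr_ge0.
Qed.

End approximation.

(** * The double limit argument from stability *)

Section double_limit.
Variables (R : realType) (V : normedModType R) (T1 T2 : Type).
Variables (f : T1 -> T2 -> V) (p : T2 -> V).

(** Pairs are chosen in turn: [a_n] in [W] approximates [p] at the earlier [b_i], and [b_n] keeps
    [p b_n] near [r] and all earlier [f a_i b_n] far from it. For [i < j], [f a_j b_i] is within
    [2 * eta] of [r], through [p b_i], which leaves [eps]. *)
Lemma unstable_sequences (W : set T1) (F : set_system T2) (r : V) eps eta :
  ProperFilter F ->
  (forall s, exists2 a, W a & all (fun b => `|f a b - p b| < eta) s) ->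
  (\forall b \near F, `|p b - r| < eta) ->
  (forall a, W a -> \forall b \near F, eps + 2 * eta < `|f a b - r|) ->
  exists (a : nat -> T1) (b : nat -> T2), forall i j : nat, (i < j)%N ->
    eps <= `|f (a i) (b j) - f (a j) (b i)|.
Proof.
move=> FF Wp pr fr.
(* The choice function is total on histories, so its specification is guarded by [WW]. *)
pose WW := all (fun t : T1 * T2 => `[< W t.1 >]).
have /boolp.choice[g gP] : forall s, exists t : T1 * T2, WW s ->
    [/\ W t.1, all (fun t' => `|f t.1 t'.2 - p t'.2| < eta) s,
        `|p t.2 - r| < eta &
        all (fun t' => eps + 2 * eta < `|f t'.1 t.2 - r|) s].
  move=> s.
  have [a Wa sa] := Wp [seq t.2 | t <- s].
  have [Ws|nWs] := boolP (WW s); last first.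
    by have [b _] := filter_ex pr; exists (a, b).
  have : \forall b \near F, all (fun t => eps + 2 * eta < `|f t.1 b - r|) s.
    move: Ws; rewrite /WW; elim: s {sa} => [_|t s IH /= /andP[/asboolP Wt Ws]].
      exact: nearW.
    by apply: filterS2 (fr _ Wt) (IH Ws) => b -> ->.
  move=> /(filterI pr)/filter_ex[b [pb sb]]; exists (a, b) => _; split=> //.
  by move: sa; rewrite all_map.
(* [h n] is the history before stage [n], latest pair first; the [n]-th pair is [g (h n)]. *)
pose h n := iter n (fun s => g s :: s) [::].
have hW n : WW (h n).
  elim: n => //= n IH; apply/andP; split=> //; apply/asboolP.
  by case: (gP _ IH).
have h_all P i j : (i < j)%N -> all P (h j) -> P (g (h i)).
  elim: j => // j IH; rewrite ltnS leq_eqVlt => /predU1P[->|ij] /= /andP[//].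
  by move=> _; exact: IH.
exists (fun n => (g (h n)).1), (fun n => (g (h n)).2) => i j ij.
have [_ /(h_all _ _ _ ij) fp _ /(h_all _ _ _ ij) far] := gP _ (hW j).
have [_ _ p_r _] := gP _ (hW i).
set u := f _ _ in far *; set v := f _ _ in fp *; set w := p _ in fp p_r.
have : `|u - r| <= `|u - v| + (`|v - w| + `|w - r|).
  by rewrite (le_trans _ (lerD (lexx _) (ler_normD _ _)))// subrKA ler_distD.
lra.
Qed.

Variable K : set V.
Hypotheses (K_compact : compact K) (pK : forall b, K (p b)).
Hypothesis p_approx : forall (s : seq T2) eta, 0 < eta ->
  exists a, all (fun b => `|f a b - p b| < eta) s.
Variables eps gamma delta : R.
Hypothesis f_stable : ~ exists (a : nat -> T1) (b : nat -> T2),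
  forall i j : nat, (i < j)%N -> eps <= `|f (a i) (b j) - f (a j) (b i)|.
Hypothesis delta_gamma : delta < gamma.

(* Otherwise the counterexamples [(b, b')] form a proper filter; along an
   ultrafilter refining it [(p b, p b')] tends to some [(r, r')], and every [a]
   has either [f a b] eventually far from [r] or [f a b'] eventually far from
   [r'].  One of the two alternatives covers enough [a] to approximate [p]. *)
Lemma stable_finite_determination : exists s : seq T1, forall b b',
  all (fun a => `|f a b - f a b'| < delta) s ->
  `|p b - p b'| <= 2 * eps + gamma.
Proof.
apply: contrapT => /forallNP no_s.
pose B s := [set bb : T2 * T2 | 2 * eps + gamma < `|p bb.1 - p bb.2| /\
  all (fun a => `|f a bb.1 - f a bb.2| < delta) s].
have B_proper : ProperFilter (filter_from setT B).
  apply: filter_from_proper => [|s _].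
    apply: filter_fromT_filter => [|s1 s2]; first by exists [::].
    by exists (s1 ++ s2) => bb [?]; rewrite all_cat => /andP[? ?].
  have /existsNP[b /existsNP[b' /not_implyP[bb' /negP]]] := no_s s.
  by rewrite -ltNge => ?; exists (b, b').
have [U [U_ultra BU]] := ultraFilterLemma B_proper.
have lim (q : T2 * T2 -> T2) : exists r : V, p \o q @ U --> r.
  (* The image of an ultrafilter is an ultrafilter, hence converges in the compact set [K]. *)
  have qU : UltraFilter (p \o q @ U).
    split=> [|G G_proper UG]; first exact: fmap_proper_filter.
    rewrite predeqE => S; split=> [GS|]; last exact: UG.
    have [//|nUS] := in_ultra_setVsetC ((p \o q) @^-1` S) U_ultra.
    have nGS : G (~` S) by exact: UG.
    by have [v []] := filter_ex (filterI GS nGS).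
  move: K_compact; rewrite compact_ultra => /(_ _ qU)[].
    by apply: (@filterS _ U _ setT); [move=> bb _; exact: pK|exact: filterT].
  by move=> r [_ rU]; exists r.
have [r rU] := lim fst; have [r' r'U] := lim snd.
(* On the path [p b], [r], [f a b], [f a b'], [r'], [p b'], the steps other than the one from
   [f a b'] to [r'] cost at most [eps + delta + 4 * eta]. The total exceeds [2 * eps + gamma], so
   that step exceeds [eps + 2 * eta]. *)
pose eta := (gamma - delta) / 6.
have eta0 : 0 < eta by rewrite divr_gt0// subr_gt0.
pose A := [set a | \forall bb \near U, eps + 2 * eta < `|f a bb.1 - r|].
pose A' := [set a | \forall bb \near U, eps + 2 * eta < `|f a bb.2 - r'|].
have rU_near : \forall bb \near U, `|p bb.1 - r| < eta.
  by apply: cvgr_distC_lt rU _ _.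
have r'U_near : \forall bb \near U, `|p bb.2 - r'| < eta.
  by apply: cvgr_distC_lt r'U _ _.
have AA' a : A a \/ A' a.
  have [|nA] := in_ultra_setVsetC
    [set bb | eps + 2 * eta < `|f a bb.1 - r|] U_ultra; first by left.
  right; have Ba : U (B [:: a]) by apply: BU; exists [:: a].
  apply: filterS3 rU_near r'U_near (filterI nA Ba) => -[b b'] /=.
  move=> br b'r' [/negP]; rewrite -leNgt => ar [far /=]; rewrite andbT => ab.
  have := (ler_distD r (p b) (p b'), ler_distD (f a b) r (p b')).
  have := (ler_distD (f a b') (f a b) (p b'), ler_distD r' (f a b') (p b')).
  rewrite (distrC r (f a b)) (distrC r') => -[? ?] [? ?].
  by rewrite /eta in br b'r' ar *; lra.
have no_A (W : set T1) (q : T2 * T2 -> T2) r0 :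
    (\forall bb \near U, `|p (q bb) - r0| < eta) ->
    (forall a, W a -> \forall bb \near U, eps + 2 * eta < `|f a (q bb) - r0|) ->
    ~ forall s, exists2 a, W a & all (fun b => `|f a b - p b| < eta) s.
  move=> pr0 Wr0 Wp; apply: f_stable.
  exact: (@unstable_sequences W (q @ U) r0 eps eta).
(* By stability [A] fails to approximate [p] on some [s], and [A'] on some [s']; an approximation on
   [s ++ s'] would lie in neither. *)
have /existsNP[s sA] := no_A A fst r rU_near (fun _ => id).
have /existsNP[s' sA'] := no_A A' snd r' r'U_near (fun _ => id).
have [a] := p_approx (s ++ s') eta0; rewrite all_cat => /andP[sa s'a].
by have [Aa|Aa] := AA' a; [apply: sA|apply: sA']; exists a.
Qed.

End double_limit.

(** * Sup-convolutions of bounded functions into l-infinity *)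

Section sup_convolution.
Variables (R : realType) (T : Type) (t0 : T) (p : T -> linfty R) (B : R).
Hypothesis pB : forall t, `|p t| <= B.

(** For [w t] equal to [c] times the distance from a point [v] to [g t], this is coordinate [k] of
    the McShane extension at [v]. *)
Definition sup_conv_coord (w : T -> R) (k : nat) : R :=
  sup (range (fun t => p t k - w t)).

Lemma coord_bounds t k : - B <= p t k <= B.
Proof. by rewrite -ler_norml (le_trans (supnorm_ub (p t) k))// pB. Qed.

Lemma sup_conv_coord_ge w t k : (forall t, 0 <= w t) ->
  p t k - w t <= sup_conv_coord w k.
Proof.
move=> w0; apply: ub_le_sup; last by exists t.
exists B => _ [t' _ <-]; have := w0 t'; have := coord_bounds t' k; lra.
Qed.

Lemma sup_conv_coord_le w m k : (forall t, p t k - w t <= m) ->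
  sup_conv_coord w k <= m.
Proof.
by move=> wm; apply: ge_sup => [|_ [t _ <-]//]; exists (p t0 k - w t0), t0.
Qed.

Lemma sup_conv_subproof w : (forall t, 0 <= w t) ->
  sup_conv_coord w \in @bounded_seq R.
Proof.
move=> w0; apply/bounded_seqP; exists (B + w t0) => k; rewrite ler_norml.
have /andP[p_ge _] := coord_bounds t0 k.
apply/andP; split; first by have := sup_conv_coord_ge t0 k w0; lra.
apply: sup_conv_coord_le => t.
by have := (w0 t, w0 t0); have := coord_bounds t k => ? [? ?]; lra.
Qed.

Definition sup_conv w (w0 : forall t, 0 <= w t) : linfty R :=
  Linfty (sup_conv_subproof w0).

Lemma sup_conv_lipschitz w w' (w0 : forall t, 0 <= w t)
    (w'0 : forall t, 0 <= w' t) m :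
  (forall t, `|w t - w' t| <= m) -> `|sup_conv w0 - sup_conv w'0| <= m.
Proof.
move=> ww'; apply: supnorm_le => k.
rewrite [X in `|X|](_ : _ = sup_conv_coord w k - sup_conv_coord w' k)//.
rewrite ler_norml lerBrDr lerBlDr addrC lerBlDr.
apply/andP; split; apply: sup_conv_coord_le => t;
  have := ww' t; rewrite ler_norml.
  by have := sup_conv_coord_ge t k w0; lra.
by have := sup_conv_coord_ge t k w'0; lra.
Qed.

(** The term at [t] itself gives the lower bound, as [w t = 0]; the hypothesis bounds every term by
    [p t k + e]. *)
Lemma sup_conv_approx w (w0 : forall t, 0 <= w t) t e :
  w t = 0 -> (forall t', `|p t' - p t| <= e + w t') ->
  `|sup_conv w0 - p t| <= e.
Proof.
move=> wt pw; apply: supnorm_le => k.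
rewrite [X in `|X|](_ : _ = sup_conv_coord w k - p t k)//.
have e0 : 0 <= e by have := pw t; rewrite subrr normr0 wt addr0.
rewrite ler_norml lerBrDr lerBlDr; apply/andP; split.
  by have := sup_conv_coord_ge t k w0; rewrite wt; lra.
apply: sup_conv_coord_le => t'.
have : `|p t' k - p t k| <= e + w t'.
  exact: le_trans (supnorm_ub (p t' - p t) k) (pw t').
by rewrite ler_norml; lra.
Qed.

End sup_convolution.

(** * Maximum distance on rows and Lipschitz extension *)

Section row_distance.
Variables (R : realType) (V : normedModType R) (n : nat).

Definition row_dist (v w : 'rV[V]_n) : R :=
  \big[Num.max/0]_i `|v ord0 i - w ord0 i|.

Lemma row_dist_ge0 v w : 0 <= row_dist v w.
Proof. exact: bigmax_ge_id. Qed.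

Lemma row_dist_ge (v w : 'rV[V]_n) i : `|v ord0 i - w ord0 i| <= row_dist v w.
Proof. exact: le_bigmax. Qed.

Lemma row_dist_le (v w : 'rV[V]_n) m :
  0 <= m -> (forall i, `|v ord0 i - w ord0 i| <= m) ->
  row_dist v w <= m.
Proof. by move=> m0 vw; apply: bigmax_le. Qed.

Lemma row_dist0 v : row_dist v v = 0.
Proof.
apply/eqP; rewrite eq_le row_dist_ge0 row_dist_le// => i.
by rewrite subrr normr0.
Qed.

Lemma row_dist_triangle u v w : row_dist u w <= row_dist u v + row_dist v w.
Proof.
apply: row_dist_le => [|i]; first by rewrite addr_ge0 ?row_dist_ge0.
by rewrite (le_trans (ler_distD (v ord0 i) _ _))// lerD// row_dist_ge.
Qed.

Lemma row_distC v w : row_dist v w = row_dist w v.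
Proof. by apply: eq_bigr => i _; rewrite distrC. Qed.

Lemma row_dist_lipschitz_continuous (W : normedModType R)
    (u : 'rV[V]_n -> W) c :
  (forall v w, `|u v - u w| <= c * row_dist v w) -> continuous u.
Proof.
move=> u_lip v A /nbhs_ballP[e /= e0 eA]; apply/nbhs_ballP.
(* [c] may be zero or negative; [|c| + 1] is positive and makes the final inequality strict at
   positive distance. *)
have c1 : 0 < `|c| + 1 by rewrite ltr_wpDl.
exists (e / (`|c| + 1)) => [|w [_ vw]]; first exact: divr_gt0.
apply: eA; rewrite -ball_normE /=; apply: le_lt_trans (u_lip v w) _.
have : row_dist v w <= e / (`|c| + 1).
  apply: row_dist_le => [|i]; first by rewrite ltW// divr_gt0.
  by have := vw ord0 i; rewrite -ball_normE => /ltW.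
rewrite ler_pdivlMr// => vwe.
have := row_dist_ge0 v w; have := ler_norm c.
have [vw0|vw0] := eqVneq (row_dist v w) 0; first by rewrite vw0 mulr0.
nra.
Qed.

End row_distance.

(* McShane's extension theorem, applied in each coordinate. *)
Lemma linfty_lipschitz_extension (R : realType) (T : Type) (t0 : T)
    (p : T -> linfty R) B n (g : T -> 'rV[linfty R]_n) c e :
  (forall t, `|p t| <= B) -> 0 <= c ->
  (forall t t', `|p t - p t'| <= e + c * row_dist (g t) (g t')) ->
  exists u : 'rV[linfty R]_n -> linfty R,
    [/\ continuous u, forall v w, `|u v - u w| <= c * row_dist v w &
        forall t, `|u (g t) - p t| <= e].
Proof.
move=> pB c0 pg.
have w0 v t : 0 <= c * row_dist v (g t) by rewrite mulr_ge0 ?row_dist_ge0.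
pose u v := sup_conv t0 pB (w0 v).
have u_lip v w : `|u v - u w| <= c * row_dist v w.
  apply: sup_conv_lipschitz => t; rewrite -mulrBr normrM (ger0_norm c0).
  rewrite ler_wpM2l// ler_norml; apply/andP; split.
    by have := row_dist_triangle w v (g t); rewrite (row_distC w v); lra.
  by have := row_dist_triangle v w (g t); lra.
exists u; split=> // [|t]; first exact: row_dist_lipschitz_continuous u_lip.
apply: sup_conv_approx => [|t']; first by rewrite row_dist0 mulr0.
by rewrite row_distC.
Qed.

(** * Diameter bounds for [phi] and its types *)

Section types_of_formulas.
Variables (R : realType) (iota : real_copy R) (L : language R).
Variables (x y : ctx (sorts L)) (K : set (linfty R)).
Variables (phi : formula iota (ctx_sum x y) K) (M : structure L).

Let f (a : env M x) (b : env M y) := eval phi (env_pair a b).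

Lemma diam_fin_num : diam phi M \is a fin_num.
Proof.
have [B [_ /(_ (B + 1))]] := compact_bounded (formula_compact phi).
rewrite ltrDl ltr01 => /(_ isT) KB.
have fB a b : `|f a b| <= B + 1 by apply: KB; exact: eval_in_val.
rewrite ge0_fin_numE.
  apply: le_lt_trans (ltry (B + 1 + (B + 1))).
  apply: ge_ereal_sup => _ [a [a' [b [b' ->]]]].
  by rewrite lee_fin (le_trans (ler_normB _ _))// lerD// fB.
apply: ereal_sup_ubound.
exists (fun=> point), (fun=> point), (fun=> point), (fun=> point).
by rewrite subrr normr0.
Qed.

Lemma diam_ge a a' b b' : `|f a b - f a' b'| <= fine (diam phi M).
Proof.
rewrite -lee_fin fineK ?diam_fin_num//; apply: ereal_sup_ubound.
by exists a, a', b, b'.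
Qed.

Lemma S_phi_approx_seq (p : env M y -> linfty R) (s : seq (env M y)) e :
  S_phi phi M p -> 0 < e -> exists a, all (fun b => `|f a b - p b| < e) s.
Proof.
move=> pp e0; have [a ae] := S_phi_approx (tnth (in_tuple s)) pp e0.
by exists a; exact/(@all_tnthP _ _ _ (in_tuple s)).
Qed.

(** The diameter is taken over [M] only, so [p] is replaced by an element of [M] close to it at [b]
    and [b']. *)
Lemma S_phi_diam (p : env M y -> linfty R) b b' :
  S_phi phi M p -> `|p b - p b'| <= fine (diam phi M).
Proof.
move=> pp; apply/ler_addgt0Pr => e e0.
have e2 : 0 < e / 2 by rewrite divr_gt0.
have [a /and3P[ab ab' _]] := S_phi_approx_seq [:: b; b'] pp e2.
have := (ler_distD (f a b) (p b) (p b'), ler_distD (f a b') (f a b) (p b')).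
rewrite (distrC (p b) (f a b)) => -[? ?]; have := diam_ge a a b b'; lra.
Qed.

End types_of_formulas.

Theorem corollary3p6 (R : realType) (iota : real_copy R) (L : language R)
  (M : structure L) (x y : ctx (sorts L)) (K : set (linfty R))
  (phi : formula iota (ctx_sum x y) K) (eps : R) (eps_gt0 : 0 < eps)
  (phi_stable : stable phi M eps) (gamma delta : R)
  (gamma_gt_delta : delta < gamma) (delta_gt0 : 0 < delta)
  (p : env M y -> linfty R) (p_type : S_phi phi M p) :
  exists psi : dual_formula x M,
    (dist_sup (df_eval phi psi) p <= (2 * eps + gamma)%:E)%E /\
    (forall q q' : env M x -> linfty R,
       S_phi_dual phi M q -> S_phi_dual phi M q' ->
       (`|df_eval_type psi q - df_eval_type psi q'|%:E
          <= diam phi M * (delta^-1)%:E * dist_sup q q')%E).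
Proof.
have K_compact := formula_compact phi.
have pK b : K (p b) by exact: S_phi_val p_type.
have [B [_ /(_ (B + 1))]] := compact_bounded K_compact.
rewrite ltrDl ltr01 => /(_ isT) KB.
have pB b : `|p b| <= B + 1 by exact: KB.
have [s s_det] := stable_finite_determination K_compact pK
  (fun s e => S_phi_approx_seq s p_type) phi_stable gamma_gt_delta.
pose a := tnth (in_tuple s).
pose g (b : env M y) := \row_i eval phi (env_pair (a i) b).
set D := fine (diam phi M).
have D_ge0 : 0 <= D.
  exact: le_trans (normr_ge0 _) (S_phi_diam point point p_type).
pose c := D / delta.
have c_ge0 : 0 <= c by rewrite divr_ge0// ltW.
have pg b b' : `|p b - p b'| <= 2 * eps + gamma + c * row_dist (g b) (g b').
  (* Either the rows agree within [delta] and [s_det] applies, or their distance is at least [delta]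
     and [c * delta = D] suffices. *)
  have [/s_det pbb'|] := boolP (all (fun a => `|eval phi (env_pair a b) -
      eval phi (env_pair a b')| < delta) s).
    by rewrite (le_trans pbb')// lerDl mulr_ge0 ?row_dist_ge0.
  rewrite -has_predC => /(@has_tnthP _ _ _ (in_tuple s))[i /=].
  rewrite -leNgt => far; rewrite (le_trans (S_phi_diam b b' p_type))//.
  have : delta <= row_dist (g b) (g b').
    rewrite (le_trans far)//.
    by have := row_dist_ge (g b) (g b') i; rewrite !mxE.
  move=> /(ler_wpM2l c_ge0); rewrite {1}/c divfK ?gt_eqF// -/D; lra.
have [u [u_cont u_lip u_approx]] :=
  linfty_lipschitz_extension (fun=> point) pB c_ge0 pg.
exists (DualFormula u_cont a); split.
  by apply: ge_ereal_sup => _ [b _ <-]; rewrite lee_fin; exact: u_approx.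
(* [u] is Lipschitz on all rows, also on those of types not realized in [M]. *)
move=> q q' _ _; apply: le_trans (_ : (c * row_dist (\row_i q (a i))
  (\row_i q' (a i)))%:E <= _)%E; first by rewrite lee_fin; exact: u_lip.
have -> : (diam phi M * (delta^-1)%:E = c%:E)%E.
  by rewrite /c EFinM fineK ?diam_fin_num.
rewrite EFinM lee_wpmul2l ?lee_fin//.
have qq' a' : (`|q a' - q' a'|%:E <= dist_sup q q')%E.
  by apply: ereal_sup_ubound; exists a'.
(* One tuple shows that [dist_sup q q'] is nonnegative: this excludes minus infinity and covers an
   empty parameter list. *)
have := qq' (fun=> point).
case: (dist_sup q q') qq' => [r| |] qq' //=.
  rewrite !lee_fin => r0; apply: row_dist_le => [|i].
    exact: le_trans r0.
  by rewrite !mxE -lee_fin.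
by move=> _; rewrite leey.
Qed.
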